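(* Let $0\le m<n$ be integers and let $A$ be an $n\times n$ real positive definite matrix with eigenvalues $\lambda_1(A),\dots,\lambda_n(A)$, indexed in nondecreasing order, and corresponding eigenvectors $v_1(A),\dots,v_n(A)$. The optimal solutions to $$\underset{X}{\text{minimize}}\ \operatorname{tr}(X^{-1}A)-\log\det(X^{-1}A)\quad\text{subject to}\quad X\in\mathcal{L}_{m,n},\ X\succ0$$ for which $v_k(X)=v_k(A)$ for all $k\in\{1,\dots,n\}$ are precisely those such that $$\lambda_i(X)=\lambda=\frac{\lambda_l(A)+\lambda_{l+1}(A)+\dots+\lambda_{l+n-m-1}(A)}{n-m}\quad\text{if } i\in\{l,\dots,l+n-m-1\},$$ $\lambda_i(X)=\lambda_i(A)$ otherwise, and $l$ is an integer (in $\{1,\dots,m+1\}$) that minimizes $$\sum_{i=l}^{l+n-m-1}\left(\frac{\lambda_i(A)}{\lambda}-\log\left(\frac{\lambda_i(A)}{\lambda}\right)\right),$$ where $\lambda$ depends on $l$ as displayed.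
   Context: $\mathcal{L}_{m,n}$ denotes the set of real $n\times n$ matrices $M$ that can be written as $M=\beta I+\sum_{i=1}^m a_iu_iu_i^T$ with $\beta,a_i\in\mathbb{R}$ and $u_i\in\mathbb{R}^n$. Positive definite matrices are understood to be symmetric, and $X\succ0$ means that $X$ is positive definite. The eigenvectors $v_1(A),\dots,v_n(A)$ form a fixed orthonormal basis, with $v_k(A)$ belonging to $\lambda_k(A)$. The condition $v_k(X)=v_k(A)$ for all $k$ means that each $v_k(A)$ is an eigenvector of $X$, and $\lambda_k(X)$ then denotes the eigenvalue of $X$ belonging to that eigenvector (so the $\lambda_k(X)$ are indexed by the eigenvectors of $A$).
   Formalization: If A has repeated eigenvalues, ''only if'' fails for a fixed indexing (e.g. A=diag(1,1,10,10), m=1, X=diag(7,1,7,7) is optimal); the formula is therefore asserted up to a permutation of indices carrying equal eigenvalues of A. *)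

(* Defs.v *)
From HB Require Import structures.
From mathcomp Require Import all_boot all_order all_algebra all_fingroup.
From mathcomp Require Import reals exp.
Set Implicit Arguments.
Unset Strict Implicit.
Unset Printing Implicit Defensive.
Import Order.TTheory GRing.Theory Num.Theory.
Local Open Scope ring_scope.

Definition posdef (R : realType) (n : nat) (X : 'M[R]_n) : Prop :=
  X^T = X /\ forall x : 'cV[R]_n, x != 0 -> 0 < (x^T *m X *m x) 0 0.

Definition low_rank_update (R : realType) (m n : nat) (M : 'M[R]_n) : Prop :=
  exists (beta : R) (a : 'I_m -> R) (u : 'I_m -> 'cV[R]_n),
    M = beta%:M + \sum_(i < m) a i *: (u i *m (u i)^T).

Definition objective (R : realType) (n : nat) (A X : 'M[R]_n) : R :=
  \tr (invmx X *m A) - ln (\det (invmx X *m A)).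

Definition feasible (R : realType) (m n : nat) (X : 'M[R]_n) : Prop :=
  low_rank_update m X /\ posdef X.

Definition optimal (R : realType) (m n : nat) (A X : 'M[R]_n) : Prop :=
  feasible m X /\
  forall Y : 'M[R]_n, feasible m Y -> objective A X <= objective A Y.

(* An orthonormal family of [n] vectors of R^n is automatically a basis. *)
Definition orthonormal_basis (R : realType) (n : nat)
    (v : 'I_n -> 'cV[R]_n) : Prop :=
  forall i j : 'I_n, ((v i)^T *m v j) 0 0 = (i == j)%:R.

Definition eigenpairs (R : realType) (n : nat) (M : 'M[R]_n)
    (lam : 'I_n -> R) (v : 'I_n -> 'cV[R]_n) : Prop :=
  forall k : 'I_n, M *m v k = lam k *: v k.

(* Indices start at 0: the block of length n - m starting at l is
   {l, ..., l + n - m - 1}, and l ranges over {0, ..., m}, i.e. 'I_m.+1. *)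
Definition in_block (m n : nat) (l : 'I_m.+1) (i : 'I_n) : bool :=
  (l <= i < l + (n - m))%N.

Definition block_mean (R : realType) (m n : nat) (lam : 'I_n -> R)
    (l : 'I_m.+1) : R :=
  (\sum_(i < n | in_block l i) lam i) / (n - m)%:R.

Definition block_cost (R : realType) (m n : nat) (lam : 'I_n -> R)
    (l : 'I_m.+1) : R :=
  \sum_(i < n | in_block l i)
    (lam i / block_mean lam l - ln (lam i / block_mean lam l)).

Definition block_minimizer (R : realType) (m n : nat) (lam : 'I_n -> R)
    (l : 'I_m.+1) : Prop :=
  forall l' : 'I_m.+1, block_cost lam l <= block_cost lam l'.

Definition block_spectrum (R : realType) (m n : nat) (lam : 'I_n -> R)
    (l : 'I_m.+1) (i : 'I_n) : R :=
  if in_block l i then block_mean lam l else lam i.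

(* Nondecreasing order fixes the indexing of the eigenpairs only up to a
   permutation of indices carrying equal eigenvalues, and the block of
   averaged eigenvalues may end inside such a tie.  For the spectrum
   (1, 1, 10, 10) and m = 1 the best block averages 1, 10, 10, and either of
   the two eigenvectors of eigenvalue 1 may be the one outside the block.
   For pairwise distinct eigenvalues only s = 1 qualifies. *)
Definition tie_relabelling (R : realType) (n : nat) (lam : 'I_n -> R)
    (s : 'S_n) : Prop :=
  forall i : 'I_n, lam (s i) = lam i.

(* Main.v *)
Require Import Defs.
From HB Require Import structures.
From mathcomp Require Import all_boot all_order all_algebra all_fingroup.
From mathcomp Require Import reals exp.
From mathcomp Require Import complex ring lra zify.
Import Order.TTheory GRing.Theory Num.Theory.
Local Open Scope ring_scope.

(* With [sub_ln x = x - ln x >= 1] and [D] the doubly stochastic matrix of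
   squared overlaps between the eigenvectors of [A] and those of a feasible
   [Y], the objective is the sum of [D i j * sub_ln (lam_i / d_j)].  A
   rearrangement inequality bounds it below by its value for the sorted
   pairing, in which the at least [n - m] equal eigenvalues of [Y] fill a
   contiguous block; off that block each term is at least 1, and on it the best
   common value is the mean.  If [X] shares the eigenvectors of [A] and is
   optimal, its spectrum is [lam] off a set [S] of size [n - m] and the mean on
   [S]; since [sub_ln] is strictly monotone on each side of 1, an exchange shows
   that no eigenvalue outside [S] lies strictly between two of [S], so [S] is a
   block up to ties. *)

Set Implicit Arguments.
Unset Strict Implicit.

(** * The function [x - ln x] *)

Definition sub_ln (R : realType) (x : R) : R := x - ln x.

Lemma ln_lt_sub1 (R : realType) (x : R) : 0 < x -> x != 1 -> ln x < x - 1.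
Proof.
move=> x0 x1; have := @expR_gt1Dx R (ln x); rewrite lnK ?posrE // ln_eq0 //.
by move=> /(_ x1); lra.
Qed.

Lemma sub_ln1 (R : realType) : sub_ln 1 = 1 :> R.
Proof. by rewrite /sub_ln ln1 subr0. Qed.

Lemma sub_ln_gt1 (R : realType) (x : R) : 0 < x -> x != 1 -> 1 < sub_ln x.
Proof. by move=> x0 x1; have := ln_lt_sub1 x0 x1; rewrite /sub_ln; lra. Qed.

Lemma sub_ln_ge1 (R : realType) (x : R) : 0 < x -> 1 <= sub_ln x.
Proof.
move=> x0; have [->|x1] := eqVneq x 1; first by rewrite sub_ln1.
exact: ltW (sub_ln_gt1 x0 x1).
Qed.

Lemma sub_ln_div (R : realType) (x y : R) :
  0 < x -> 0 < y -> sub_ln (x / y) = x / y - ln x + ln y.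
Proof. by move=> x0 y0; rewrite /sub_ln ln_div ?posrE // opprB addrA addrAC. Qed.

(** The bound [ln t < t - 1] at [t = x / y] reduces the claim to [x / y - 1 <= x - y], that is, to
    [(x - y) * (1 - 1 / y) >= 0], whose factors never have opposite signs when [y] lies between [x]
    and 1. *)
Lemma sub_ln_lt (R : realType) (x y : R) : 0 < x -> 0 < y ->
  (x < y) && (y <= 1) || (1 <= y) && (y < x) -> sub_ln y < sub_ln x.
Proof.
move=> x0 y0 xy.
have nxy : x / y != 1.
  apply/eqP => /(congr1 ( *%R^~ y)); rewrite divfK ?gt_eqF // mul1r => e.
  by move: xy; rewrite e ltxx andbF.
have := ln_lt_sub1 (divr_gt0 x0 y0) nxy; rewrite ln_div ?posrE // /sub_ln.
suff : x / y - 1 <= x - y by lra.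
have -> : x - y = (x / y - 1) * y by rewrite mulrBl divfK ?gt_eqF // mul1r.
have e1 : x / y - 1 = (x - y) / y by rewrite mulrBl divff ?gt_eqF.
rewrite -subr_ge0 e1 -[X in _ - X]mulr1 -mulrBr mulrAC.
apply: mulr_ge0; last by rewrite invr_ge0 ltW.
by case/orP: xy => /andP[h1 h2]; nra.
Qed.

(** Beyond their total, the individual entries enter only through the sum of the [ln (x i)], which
    is the same for every divisor. Replacing the mean [M] by [b] therefore costs a multiple of
    [sub_ln (M / b) - 1]. *)
Lemma sum_sub_ln_mean (R : realType) (I : finType) (P : pred I) (x : I -> R)
    (M b : R) : 0 < b -> 0 < M -> (forall i, 0 < x i) ->
  \sum_(i | P i) x i = M * #|P|%:R ->
  \sum_(i | P i) sub_ln (x i / b) =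
  \sum_(i | P i) sub_ln (x i / M) + (sub_ln (M / b) - 1) * #|P|%:R.
Proof.
move=> b0 M0 x0 hM.
have sumE c : 0 < c -> \sum_(i | P i) sub_ln (x i / c) =
    (M / c + ln c) * #|P|%:R - \sum_(i | P i) ln (x i).
  move=> c0; under eq_bigr do rewrite sub_ln_div //.
  rewrite big_split /= sumrB -mulr_suml hM sumr_const -mulr_natr; ring.
rewrite !sumE // sub_ln_div // divff ?gt_eqF //; ring.
Qed.

(** * Index windows, ties and sorting *)

Lemma card_window (n p w : nat) : (p + w <= n)%N ->
  #|[set i : 'I_n | (p <= i < p + w)%N]| = w.
Proof.
move=> pwn.
have lt (t : 'I_w) : (p + t < n)%N by have := ltn_ord t; lia.
rewrite -[RHS]card_ord -(card_imset predT (f := fun t => Ordinal (lt t))).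
  congr #|pred_of_set _|; apply/setP => i; rewrite inE; apply/idP/imsetP => [hi|[t _ ->]] /=.
    have iw : (i - p < w)%N by lia.
    by exists (Ordinal iw) => //; apply: val_inj => /=; lia.
  by have := ltn_ord t; lia.
by move=> t u [/eqP]; rewrite eqn_add2l => /eqP /val_inj.
Qed.

Lemma card_preim_perm (T : finType) (s : {perm T}) (S : {set T}) :
  #|[set i | s i \in S]| = #|S|.
Proof.
rewrite -(card_imset _ (@perm_inj _ s)); congr #|pred_of_set _|.
apply/setP => j; apply/imsetP/idP => [[i + ->]|jS]; first by rewrite inE.
by exists ((s^-1)%g j); rewrite ?inE permKV.
Qed.

(* Narrow a window containing [S] until it is full: if an end point is not in
   [S] drop it, otherwise some interior point is missing from [S] and, being
   tied with one of the end points, can be swapped with it. *)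
Lemma tie_relabelling_window (R : realType) (n : nat) (lam : 'I_n -> R)
    (S : {set 'I_n}) :
  (forall i j : 'I_n, (i <= j)%N -> lam i <= lam j) -> (0 < #|S|)%N ->
  (forall i j k, i \in S -> j \notin S -> k \in S ->
     lam i < lam j -> lam j < lam k -> False) ->
  exists s : 'S_n, tie_relabelling lam s /\
  exists l : nat, (l + #|S| <= n)%N /\
    forall i : 'I_n, (s i \in S) = (l <= i < l + #|S|)%N.
Proof.
move=> hord S0 hS; set G := (ex _).
suff narrow w : forall p (s : 'S_n), tie_relabelling lam s -> (p + w <= n)%N ->
    (forall i, s i \in S -> (p <= i < p + w)%N) -> G.
  apply: (narrow n 0%N 1%g) => [i||i _]; rewrite ?perm1 ?add0n //=.
elim: w => [|w IH] p s tie pwn win.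
  have := card_preim_perm s S; rewrite (_ : [set _ | _] = set0) ?cards0; first lia.
  by apply/setP => i; rewrite !inE; apply: contraTF isT => /win; lia.
have sub : [set i | s i \in S] \subset [set i : 'I_n | (p <= i < p + w.+1)%N].
  by apply/subsetP => i; rewrite !inE => /win.
have := subset_leqif_card sub; rewrite card_preim_perm card_window // => -[le eqS].
have [cS|ncS] := eqVneq #|S| w.+1.
  exists s; split => //; exists p; rewrite cS; split => // i.
  move: eqS; rewrite cS eqxx => /esym /(conj sub) /andP.
  by rewrite -eqEsubset => /eqP /setP /(_ i); rewrite !inE.
have pn : (p < n)%N by lia.
have qn : (p + w < n)%N by lia.
pose a := Ordinal pn; pose b := Ordinal qn.
have dropl (t : 'S_n) : tie_relabelling lam t -> t a \notin S ->
    (forall i, t i \in S -> (p <= i < p + w.+1)%N) -> G.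
  move=> tt ta wt; apply: (IH p.+1 t) => [||i iS]; [by []|lia|].
  have : i != a by apply: contraNneq ta => <-.
  by rewrite -val_eqE /=; have := wt i iS; lia.
have dropr (t : 'S_n) : tie_relabelling lam t -> t b \notin S ->
    (forall i, t i \in S -> (p <= i < p + w.+1)%N) -> G.
  move=> tt ta wt; apply: (IH p t) => [||i iS]; [by []|lia|].
  have : i != b by apply: contraNneq ta => <-.
  by rewrite -val_eqE /=; have := wt i iS; lia.
have [aS|aS] := boolP (s a \in S); last exact: dropl aS win.
have [bS|bS] := boolP (s b \in S); last exact: dropr bS win.
have [j /andP[jw jS]] : exists j : 'I_n, (p <= j < p + w.+1)%N && (s j \notin S).
  apply/existsP; apply: contraNT ncS => /existsPn h; rewrite eqS.
  apply/subsetP => j; rewrite !inE => jw; have := h j.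
  by rewrite jw /= negbK.
(* In [tperm c j * s] the transposition acts first, so the end point [c] is sent to [s j], which is
   outside [S]. *)
have swap (c : 'I_n) : c \in [:: a; b] -> lam c = lam j ->
    let t := (tperm c j * s)%g in
    [/\ tie_relabelling lam t, t c \notin S &
        forall i, t i \in S -> (p <= i < p + w.+1)%N].
  move=> cab cj t; split => [i||i]; rewrite permM ?tpermL //.
    by rewrite tie; case: tpermP => // ->.
  case: tpermP => [->|->|_ _]; [by rewrite (negPf jS)| |exact: win].
  by move: cab; rewrite !inE => /orP[]/eqP-> _ /=; lia.
have laj : lam a <= lam j by apply: hord => /=; lia.
have ljb : lam j <= lam b by apply: hord => /=; lia.
have [e|/negPf na] := eqVneq (lam a) (lam j).
  have ain : a \in [:: a; b] by rewrite inE eqxx.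
  by have [t1 t2 t3] := swap a ain e; exact: dropl t1 t2 t3.
have [e|/negPf nb] := eqVneq (lam b) (lam j).
  have bin : b \in [:: a; b] by rewrite !inE eqxx orbT.
  by have [t1 t2 t3] := swap b bin e; exact: dropr t1 t2 t3.
(* Tied with neither end point, [s j] would have its value strictly between those of two elements of
   [S]. *)
case: (hS (s a) (s j) (s b)) => //; rewrite !tie lt_neqAle.
  by rewrite na.
by rewrite eq_sym nb.
Qed.

Lemma sorting_perm (R : realType) (n : nat) (d : 'I_n -> R) :
  exists s : 'S_n, forall i j : 'I_n, (i <= j)%N -> d (s i) <= d (s j).
Proof.
pose t := [tuple d i | i < n].
have /tuple_permP [s sE] : perm_eq (sort <=%R t) t by rewrite perm_sort.
exists s => i j ij.
have st : sorted <=%R (sort <=%R t) by apply: sort_sorted; apply: le_total.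
have nthE (k : 'I_n) : nth 0 (sort <=%R t) k = d (s k).
  by rewrite sE (nth_map k) ?size_enum_ord // nth_ord_enum tnth_mktuple.
rewrite -!nthE; apply: (sorted_leq_nth le_trans le_refl) => //.
  by rewrite inE size_sort size_tuple.
by rewrite inE size_sort size_tuple.
Qed.

(** The window starts at the least index [l] of the level set. By monotonicity, an index [j] of the
    window off the level would confine the whole level set to the fewer than [k] indices from [l] to
    [j - 1]. *)
Lemma sorted_level_window (R : realType) (n k : nat) (e : 'I_n -> R) (b : R) :
  (forall i j : 'I_n, (i <= j)%N -> e i <= e j) ->
  (0 < k)%N -> (k <= #|[set i | e i == b]|)%N ->
  exists l : nat, (l + k <= n)%N /\
    forall i : 'I_n, (l <= i < l + k)%N -> e i = b.
Proof.
move=> hord k0 hk.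
have /card_gt0P [i0 hi0] := leq_trans k0 hk.
pose l := [arg min_(i < i0 | i \in [set i | e i == b]) (i : nat)].
have [lS lmin] : l \in [set i | e i == b] /\
    forall i, i \in [set i | e i == b] -> (l <= i)%N.
  by rewrite /l; case: arg_minnP.
have above (j : 'I_n) : (l <= j)%N -> e j != b ->
    [set i | e i == b] \subset [set i : 'I_n | (l <= i < l + (j - l))%N].
  move=> lj ejb; apply/subsetP => i iS; move: (lmin _ iS); move: iS.
  rewrite !inE => /eqP eib li; rewrite li /= subnKC // ltnNge; apply: contra ejb => ji.
  move: lS; rewrite inE => /eqP elb; rewrite eq_le -{1}eib -elb !hord //; lia.
have lkn : (l + k <= n)%N.
  have sub : [set i | e i == b] \subset [set i : 'I_n | (l <= i < l + (n - l))%N].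
    by apply/subsetP => i /lmin; rewrite inE; have := ltn_ord i; lia.
  have := subset_leq_card sub; rewrite card_window; have := ltn_ord l; lia.
exists l; split=> // j jw; apply/eqP; apply: contraT => ejb.
have := subset_leq_card (above j _ ejb); rewrite card_window; have := ltn_ord j; lia.
Qed.

(** * The rearrangement inequality *)

(* [p] is a concave potential with supergradient [g j] at [f j]; it is the dual
   certificate for optimality of the identity pairing. *)
Lemma monotone_potential (R : realType) (f g : nat -> R) :
  {homo f : i j / (i <= j)%N >-> i <= j} ->
  {homo g : i j / (i <= j)%N >-> j <= i} ->
  exists p : nat -> R, forall i j, p i - p j <= g j * (f i - f j).
Proof.
move=> hf hg.
(* The potential sums the increments of [f] with weights [g]; since [g] is nonincreasing, replacing
   every weight between [i] and [j] by [g j] errs in the required direction on either side of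
   [j]. *)
exists (fun i => \sum_(0 <= t < i) g t * (f t.+1 - f t)) => i j.
case: (leqP j i) => ij.
  rewrite (big_cat_nat (n := j)) //= addrAC subrr add0r -(telescope_sumr _ ij).
  rewrite mulr_sumr !big_nat; apply: ler_sum => t /andP[jt _].
  by rewrite ler_wpM2r ?hg // subr_ge0 hf.
rewrite -lerN2 opprB -mulrN opprB (big_cat_nat (n := i) (p := j)) ?(ltnW ij) //=.
rewrite addrAC subrr add0r -(telescope_sumr _ (ltnW ij)).
rewrite mulr_sumr !big_nat; apply: ler_sum => t /andP[_ tj].
by rewrite ler_wpM2r ?hg // ?subr_ge0 ?hf // ltnW.
Qed.

(** Weak duality of optimal transport: the certificate gives [p i - p j + x j * y j <= x i * y j]
    entrywise. Averaging with [D] cancels the potentials, by the row and column sums, and leaves the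
    identity pairing on the left. *)
Lemma doubly_stochastic_rearrangement (R : realType) (n : nat)
    (D : 'I_n -> 'I_n -> R) (x y : 'I_n -> R) :
  (forall i j, 0 <= D i j) ->
  (forall i, \sum_j D i j = 1) -> (forall j, \sum_i D i j = 1) ->
  (forall i j : 'I_n, (i <= j)%N -> x i <= x j) ->
  (forall i j : 'I_n, (i <= j)%N -> y j <= y i) ->
  \sum_i x i * y i <= \sum_i \sum_j D i j * (x i * y j).
Proof.
case: n D x y => [|n] D x y D0 rows cols hx hy; first by rewrite !big_ord0.
(* Potentials live on [nat], so indices are clamped at the last index [n], which preserves
   monotonicity. *)
pose ext (z : 'I_n.+1 -> R) t := z (inord (minn t n)).
have extE z (i : 'I_n.+1) : ext z i = z i.
  congr z; apply: val_inj; rewrite /= inordK; have := ltn_ord i; lia.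
have ext_le i j : (i <= j)%N ->
    (nat_of_ord (inord (minn i n) : 'I_n.+1) <= (inord (minn j n) : 'I_n.+1))%N.
  by move=> ij; rewrite !inordK; lia.
have [p hp] := @monotone_potential R (ext x) (ext y)
  (fun i j ij => hx _ _ (ext_le i j ij)) (fun i j ij => hy _ _ (ext_le i j ij)).
have {}hp (i j : 'I_n.+1) : p i - p j + x j * y j <= x i * y j.
  by have := hp i j; rewrite !extE; lra.
have -> : \sum_i x i * y i =
    \sum_i \sum_j D i j * (p i - p j + x j * y j).
  under [RHS]eq_bigr do under eq_bigr do rewrite mulrDr mulrBr.
  under [RHS]eq_bigr do rewrite big_split sumrB /= -mulr_suml rows mul1r.
  rewrite big_split sumrB /= exchange_big /=.
  under [X in _ - X]eq_bigr do rewrite -mulr_suml cols mul1r.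
  rewrite subrr add0r exchange_big /=; apply: eq_bigr => j _.
  by rewrite -mulr_suml cols mul1r.
by apply: ler_sum => i _; apply: ler_sum => j _; rewrite ler_wpM2l.
Qed.

(** * Cost of a spectrum and averaging over a set *)

(** This is the objective for two matrices with common orthonormal eigenvectors and spectra [lam]
    and [e]. *)
Definition spectral_cost (R : realType) (n : nat) (lam e : 'I_n -> R) : R :=
  \sum_i sub_ln (lam i / e i).

(** Generalises the block spectrum to sets that need not be contiguous, as the exchange argument
    requires. *)
Definition averaged_on (R : realType) (n : nat) (lam : 'I_n -> R)
    (P : pred 'I_n) (i : 'I_n) : R :=
  if P i then (\sum_(j | P j) lam j) / #|P|%:R else lam i.

Lemma mean_gt0 (R : realType) (n : nat) (lam : 'I_n -> R) (P : pred 'I_n) :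
  (forall i, 0 < lam i) -> (0 < #|P|)%N -> 0 < (\sum_(j | P j) lam j) / #|P|%:R.
Proof.
move=> lam0 P0; rewrite divr_gt0 ?ltr0n //.
by have /card_gt0P [i iP] := P0; rewrite (bigD1 i) //= ltr_pwDl // sumr_ge0 // => j _; rewrite ltW.
Qed.

Lemma averaged_on_gt0 (R : realType) (n : nat) (lam : 'I_n -> R) (P : pred 'I_n) :
  (forall i, 0 < lam i) -> forall i, 0 < averaged_on lam P i.
Proof.
move=> lam0 i; rewrite /averaged_on; case: ifP => // iP.
by apply: mean_gt0 => //; apply/card_gt0P; exists i.
Qed.

(** Both corrections are nonnegative because [sub_ln] is at least 1: one measures how far [b] is
    from the mean on [P], the other how far [e] is from [lam] off [P]. *)
Lemma spectral_cost_averaged_on (R : realType) (n : nat) (lam e : 'I_n -> R)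
    (P : pred 'I_n) (b : R) :
  (forall i, 0 < lam i) -> (0 < #|P|)%N -> 0 < b ->
  (forall i, P i -> e i = b) ->
  spectral_cost lam e = spectral_cost lam (averaged_on lam P)
    + (sub_ln ((\sum_(j | P j) lam j) / #|P|%:R / b) - 1) * #|P|%:R
    + \sum_(i | ~~ P i) (sub_ln (lam i / e i) - 1).
Proof.
move=> lam0 P0 b0 eb; set M := _ / #|P|%:R.
rewrite /spectral_cost (bigID P) /= [X in _ = X + _ + _](bigID P) /=.
under eq_bigr => i iP do rewrite eb //.
rewrite (@sum_sub_ln_mean _ _ P lam M b) ?mean_gt0 //; last first.
  by rewrite /M divfK // pnatr_eq0 -lt0n.
rewrite -!addrA; congr (_ + _).
  by apply: eq_bigr => i iP; rewrite /averaged_on iP.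
rewrite [RHS]addrCA; congr (_ + _).
rewrite -big_split /=; apply: eq_bigr => i iP.
by rewrite /averaged_on (negPf iP) divff ?gt_eqF // sub_ln1 addrC subrK.
Qed.

Lemma averaged_on_optimal (R : realType) (n : nat) (lam e : 'I_n -> R)
    (P : pred 'I_n) (b : R) :
  (forall i, 0 < lam i) -> (forall i, 0 < e i) -> (0 < #|P|)%N ->
  (forall i, P i -> e i = b) ->
  spectral_cost lam (averaged_on lam P) <= spectral_cost lam e ?= iff
    [forall i, e i == averaged_on lam P i].
Proof.
move=> lam0 e0 P0 eb.
have [i0 i0P] : exists i, P i by exact/card_gt0P.
have b0 : 0 < b by rewrite -(eb i0).
have M0 := mean_gt0 lam0 P0.
have t1 : 0 <= (sub_ln ((\sum_(j | P j) lam j) / #|P|%:R / b) - 1) * #|P|%:R.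
  by rewrite mulr_ge0 // subr_ge0 sub_ln_ge1 // divr_gt0.
have t2 i : ~~ P i -> 0 <= sub_ln (lam i / e i) - 1.
  by move=> _; rewrite subr_ge0 sub_ln_ge1 // divr_gt0.
split; rewrite (spectral_cost_averaged_on lam0 P0 b0 eb) -addrA.
  by rewrite lerDl addr_ge0 // sumr_ge0.
rewrite -subr_eq0 opprD addNKr oppr_eq0 paddr_eq0 ?sumr_ge0 // mulf_eq0.
rewrite pnatr_eq0 -[#|P| == _]negbK -lt0n P0 orbF psumr_eq0 //.
have divE (x y : R) : 0 < x -> 0 < y -> (sub_ln (x / y) - 1 == 0) = (y == x).
  move=> x0 y0; rewrite subr_eq0; have [->|yx] := eqVneq y x.
    by rewrite divff ?lt0r_neq0 // sub_ln1 eqxx.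
  rewrite gt_eqF // sub_ln_gt1 ?divr_gt0 //; apply: contraNneq yx => h.
  by rewrite -[x](divfK (lt0r_neq0 y0)) h mul1r.
rewrite divE //; apply/andP/forallP => [[/eqP bM /allP h] i|h].
  rewrite /averaged_on; case: ifPn => iP; first by rewrite eb // bM.
  by have := h i (mem_index_enum i); rewrite iP /= divE.
split; first by have := h i0; rewrite /averaged_on i0P eb.
apply/allP => i _; apply/implyP => iP.
by have := h i; rewrite /averaged_on (negPf iP) divE.
Qed.

(** The intermediate spectrum [e] keeps the old mean [M] on the exchanged set. Passing to [e] alters
    only the terms at [i] and [j], for a strict gain, and averaging anew cannot raise the cost. *)
Lemma averaged_on_exchange (R : realType) (n : nat) (lam : 'I_n -> R)
    (S : {set 'I_n}) (i j : 'I_n) :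
  let M := (\sum_(x in S) lam x) / #|S|%:R in
  (forall x, 0 < lam x) -> i \in S -> j \notin S ->
  sub_ln (lam j / M) < sub_ln (lam i / M) ->
  spectral_cost lam (averaged_on lam (mem (j |: (S :\ i)))) <
  spectral_cost lam (averaged_on lam (mem S)).
Proof.
move=> M lam0 iS jS ij.
have M0 : 0 < M by apply: mean_gt0 => //; apply/card_gt0P; exists i.
have nij : j != i by apply: contraNneq jS => ->.
pose e x := if x == i then lam i else if x == j then M else averaged_on lam (mem S) x.
have eM x : x \in j |: (S :\ i) -> e x = M.
  rewrite !inE /e => /orP[/eqP->|/andP[/negPf-> xS]]; first by rewrite (negPf nij) eqxx.
  by case: ifP => // _; rewrite /averaged_on /= xS.
have e0 x : 0 < e x.
  by rewrite /e; case: ifP => // _; case: ifP => // _; apply: averaged_on_gt0.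
apply: (@le_lt_trans _ _ (spectral_cost lam e)).
  apply: (averaged_on_optimal (b := M) lam0 e0 _ eM).1.
  by apply/card_gt0P; exists j; rewrite !inE eqxx.
rewrite /spectral_cost (bigD1 i) // (bigD1 j) //= [X in _ < X](bigD1 i) //.
rewrite [X in _ < _ + X](bigD1 j) //= [ltLHS]addrA [ltRHS]addrA; apply: ltr_leD; last first.
  apply: ler_sum => x /andP[/negPf xi /negPf xj].
  by rewrite /e xi xj.
rewrite /e eqxx (negPf nij) eqxx /averaged_on /= iS (negPf jS) !divff ?gt_eqF //.
by rewrite addrC ltrD2r.
Qed.

(** * Block spectra *)

Lemma card_in_block (m n : nat) (l : 'I_m.+1) : (m < n)%N ->
  #|[pred i : 'I_n | in_block l i]| = (n - m)%N.
Proof.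
move=> mn; rewrite -[RHS](@card_window n l (n - m)); last by have := ltn_ord l; lia.
by apply: eq_card => i; rewrite !inE.
Qed.

Lemma block_spectrumE (R : realType) (m n : nat) (lam : 'I_n -> R) (l : 'I_m.+1) :
  (m < n)%N -> block_spectrum lam l =1 averaged_on lam [pred i | in_block l i].
Proof.
by move=> mn i; rewrite /block_spectrum /averaged_on /block_mean card_in_block.
Qed.

(** Each of the [m] indices off the block contributes [sub_ln 1], which is 1; hence comparing block
    costs amounts to comparing spectral costs. *)
Lemma spectral_cost_block (R : realType) (m n : nat) (lam : 'I_n -> R)
    (l : 'I_m.+1) : (m < n)%N -> (forall i, 0 < lam i) ->
  spectral_cost lam (block_spectrum lam l) = block_cost lam l + m%:R.
Proof.
move=> mn lam0; rewrite /spectral_cost (bigID (fun i => in_block l i)) /=.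
congr (_ + _).
  by apply: eq_bigr => i il; rewrite /block_spectrum il.
under eq_bigr => i il do rewrite /block_spectrum (negPf il) divff ?gt_eqF // sub_ln1.
rewrite sumr_const; congr (_ *+ _).
have := cardC [pred i : 'I_n | in_block l i]; rewrite card_in_block // card_ord.
by rewrite (eq_card (B := [predC [pred i : 'I_n | in_block l i]])) //; lia.
Qed.

Lemma optimal_spectrum_block (R : realType) (m n : nat) (lam mu : 'I_n -> R)
    (S : {set 'I_n}) (b : R) : (m < n)%N ->
  (forall i j : 'I_n, (i <= j)%N -> lam i <= lam j) ->
  (forall i, 0 < lam i) -> (forall i, 0 < mu i) ->
  #|S| = (n - m)%N -> (forall i, i \in S -> mu i = b) ->
  (forall S' : {set 'I_n}, #|S'| = (n - m)%N ->
     spectral_cost lam mu <= spectral_cost lam (averaged_on lam (mem S'))) ->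
  exists s : 'S_n, tie_relabelling lam s /\
  exists l : 'I_m.+1, block_minimizer lam l /\
    forall i : 'I_n, mu (s i) = block_spectrum lam l i.
Proof.
move=> mn hord lam0 mu0 cS mub hopt.
have S0 : (0 < #|S|)%N by rewrite cS subn_gt0.
(* The average over [S] is itself a competitor, so [mu] attains the bound and the equality case
   determines it. *)
have muE : mu =1 averaged_on lam (mem S).
  have [le eq] := averaged_on_optimal lam0 mu0 S0 mub.
  by move: eq; rewrite eq_le le hopt // => /esym /forallP h i; apply/eqP.
have costE : spectral_cost lam mu = spectral_cost lam (averaged_on lam (mem S)).
  by apply: eq_bigr => i _; rewrite muE.
pose M := (\sum_(x in S) lam x) / #|S|%:R.
have M0 : 0 < M by exact: mean_gt0.
have noexch i j : i \in S -> j \notin S -> ~ sub_ln (lam j / M) < sub_ln (lam i / M).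
  move=> iS jS /(averaged_on_exchange lam0 iS jS); rewrite -costE ltNge hopt //.
  by rewrite -cS (cardsD1 i S) iS cardsU1 !inE (negPf jS) andbF.
have [i j k iS jS kS ij jk|s [tie [l [lS sS]]]] := tie_relabelling_window hord S0.
  (* The side of the mean on which [lam j] lies decides which outer element to exchange: [j] is
     nearer to [M] than [i] from below, or than [k] from above. *)
  have [jM|Mj] := leP (lam j) M.
    apply: (noexch i j iS jS); apply: sub_ln_lt; [exact: divr_gt0|exact: divr_gt0|].
    by rewrite ltr_pM2r ?invr_gt0 // ij ler_pdivrMr // mul1r jM.
  apply: (noexch k j kS jS); apply: sub_ln_lt; [exact: divr_gt0|exact: divr_gt0|].
  apply/orP; right; rewrite ltr_pM2r ?invr_gt0 // jk ler_pdivlMr // mul1r ltW //.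
have lm : (l < m.+1)%N by move: lS; rewrite cS; lia.
exists s; split=> //; exists (Ordinal lm).
have sE i : mu (s i) = block_spectrum lam (Ordinal lm) i.
  rewrite muE /averaged_on /block_spectrum /in_block /= sS cS; case: ifP => // _.
  rewrite /block_mean; congr (_ / _).
  rewrite (reindex_inj (@perm_inj _ s)) /=; apply: eq_big => [x|x _].
    by rewrite sS cS.
  exact: tie.
split=> // l'; rewrite -(lerD2r m%:R) -!spectral_cost_block //.
have <- : spectral_cost lam mu = spectral_cost lam (block_spectrum lam (Ordinal lm)).
  rewrite /spectral_cost (reindex_inj (@perm_inj _ s)) /=.
  by apply: eq_bigr => x _; rewrite sE tie.
apply: (le_trans (hopt [set i | in_block l' i] _)).
  by rewrite cardsE card_in_block.
apply: ler_sum => i _; rewrite block_spectrumE // /averaged_on /= !inE.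
rewrite cardsE; under eq_bigl do rewrite inE; exact: lexx.
Qed.

(** Sorting makes the level set of [b] contain a full block, and averaging [lam] over that block
    cannot raise the cost. *)
Lemma sorted_cost_bound (R : realType) (m n : nat) (lam e : 'I_n -> R) (b : R) :
  (m < n)%N -> (forall i, 0 < lam i) -> (forall i, 0 < e i) ->
  (forall i j : 'I_n, (i <= j)%N -> e i <= e j) ->
  (n - m <= #|[set i | e i == b]|)%N ->
  exists l : 'I_m.+1, block_cost lam l + m%:R <= spectral_cost lam e.
Proof.
move=> mn lam0 e0 hord hb.
have [|l [ln lb]] := sorted_level_window hord _ hb; first by rewrite subn_gt0.
have lm : (l < m.+1)%N by lia.
exists (Ordinal lm); rewrite -spectral_cost_block //.
rewrite /spectral_cost; under eq_bigr do rewrite block_spectrumE //.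
apply: (averaged_on_optimal (b := b) lam0 e0 _ _).1 => //.
by rewrite card_in_block // subn_gt0.
Qed.

(** * Conjugated diagonal matrices and rank *)

Local Open Scope sesquilinear_scope.

(** The principal submatrix on the nonzero diagonal entries is invertible, and extracting a
    submatrix cannot raise the rank. *)
Lemma rank_diag_mx_ge (F : fieldType) (n : nat) (d : 'I_n -> F) :
  (#|[set i | d i != 0%R]| <= \rank (diag_mx (\row_i d i)))%N.
Proof.
set S := [set i | _].
pose f (i : 'I_#|S|) : 'I_n := enum_val i.
have -> : #|S| = \rank (mxsub f f (diag_mx (\row_i d i))).
  apply/esym/mxrank_unit; rewrite unitmxE.
  have -> : mxsub f f (diag_mx (\row_i d i)) = diag_mx (\row_i d (f i)).
    by apply/matrixP => i j; rewrite !mxE (inj_eq enum_val_inj).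
  rewrite det_diag unitfE; apply/prodf_neq0 => i _; rewrite mxE.
  by have := enum_valP i; rewrite inE.
rewrite mxsubrc rowsubE; apply: leq_trans (mxrankM_maxr _ _) _.
rewrite -mxrank_tr trmx_mxsub rowsubE; apply: leq_trans (mxrankM_maxr _ _) _.
by rewrite mxrank_tr.
Qed.

(** [P] stands for the inverse of [Q]; as a separate argument it can be a transpose over [R] or a
    conjugate transpose over [R[i]]. *)
Definition conj_diag (K : comUnitRingType) (n : nat) (Q P : 'M[K]_n)
    (d : 'I_n -> K) : 'M[K]_n := Q *m diag_mx (\row_i d i) *m P.

Lemma det_conj_diag (K : comUnitRingType) (n : nat) (Q P : 'M[K]_n) (d : 'I_n -> K) :
  Q *m P = 1%:M -> \det (conj_diag Q P d) = \prod_i d i.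
Proof.
move=> QP; rewrite /conj_diag !det_mulmx mulrAC -det_mulmx QP det1 mul1r det_diag.
by apply: eq_bigr => i _; rewrite mxE.
Qed.

Lemma conj_diag_mul (K : comUnitRingType) (n : nat) (Q P : 'M[K]_n) (d e : 'I_n -> K) :
  P *m Q = 1%:M ->
  conj_diag Q P d *m conj_diag Q P e = conj_diag Q P (fun i => d i * e i).
Proof.
move=> PQ; rewrite /conj_diag !mulmxA -(mulmxA _ P Q) PQ mulmx1 -(mulmxA Q).
by congr (_ *m _ *m _); apply/matrixP => i j; rewrite mul_diag_mx !mxE mulrnAr.
Qed.

Lemma conj_diag_const (K : comUnitRingType) (n : nat) (Q P : 'M[K]_n) (c : K) :
  Q *m P = 1%:M -> conj_diag Q P (fun=> c) = c%:M.
Proof.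
move=> QP; rewrite /conj_diag (_ : diag_mx _ = c%:M).
  by rewrite mul_mx_scalar -scalemxAl QP scalemx1.
by apply/matrixP => i j; rewrite !mxE.
Qed.

Lemma conj_diagB (K : comUnitRingType) (n : nat) (Q P : 'M[K]_n) (d e : 'I_n -> K) :
  conj_diag Q P d - conj_diag Q P e = conj_diag Q P (fun i => d i - e i).
Proof.
rewrite /conj_diag -mulmxBl -mulmxBr -raddfB /=.
by congr (_ *m diag_mx _ *m _); apply/rowP => i; rewrite !mxE.
Qed.

Lemma invmx_conj_diag (F : fieldType) (n : nat) (Q P : 'M[F]_n) (d : 'I_n -> F) :
  P *m Q = 1%:M -> (forall i, d i != 0) ->
  invmx (conj_diag Q P d) = conj_diag Q P (fun i => (d i)^-1).
Proof.
move=> PQ d0; have QP := mulmx1C PQ.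
have dd : conj_diag Q P d *m conj_diag Q P (fun i => (d i)^-1) = 1%:M.
  rewrite conj_diag_mul // -(conj_diag_const 1 QP); congr (_ *m diag_mx _ *m _).
  by apply/rowP => i; rewrite !mxE divff.
by have [u _] := mulmx1_unit dd; rewrite -[RHS](mulKmx u) dd mulmx1.
Qed.

Lemma rank_conj_diag_ge (F : fieldType) (n : nat) (Q P : 'M[F]_n) (d : 'I_n -> F)
    (b : F) : P *m Q = 1%:M ->
  (#|[set i | d i != b]| <= \rank (conj_diag Q P d - b%:M)%R)%N.
Proof.
move=> PQ; have QP := mulmx1C PQ.
rewrite -(conj_diag_const b QP) conj_diagB.
have -> : [set i | d i != b] = [set i | d i - b != 0].
  by apply/setP => i; rewrite !inE subr_eq0.
apply: leq_trans (rank_diag_mx_ge _) _.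
set e := (fun i => d i - b).
have -> : diag_mx (\row_i e i) = P *m conj_diag Q P e *m Q.
  by rewrite /conj_diag !mulmxA PQ mul1mx -mulmxA PQ mulmx1.
by rewrite (leq_trans (mxrankM_maxl _ _)) // mxrankM_maxr.
Qed.

(** Once [beta] is subtracted, the remaining sum factors through dimension [m]. *)
Lemma low_rank_update_rank (R : realType) (m n : nat) (M : 'M[R]_n) :
  low_rank_update m M -> exists b : R, (\rank (M - b%:M)%R <= m)%N.
Proof.
move=> [b [a [u ->]]]; exists b; rewrite addrAC subrr add0r.
have -> : \sum_(i < m) a i *: (u i *m (u i)^T) =
    (\matrix_(i < n, j < m) (a j * u j i 0)) *m (\matrix_(j < m, i < n) u j i 0).
  apply/matrixP => i j; rewrite summxE !mxE; apply: eq_bigr => k _.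
  by rewrite !mxE big_ord1 !mxE mulrA.
exact: leq_trans (mxrankM_maxl _ _) (rank_leq_col _).
Qed.

(** * Matrices with a prescribed spectrum in the basis [v] *)

Definition basis_mx (R : realType) (n : nat) (v : 'I_n -> 'cV[R]_n) : 'M[R]_n :=
  \matrix_(i, k) v k i 0.

Definition with_spectrum (R : realType) (n : nat) (v : 'I_n -> 'cV[R]_n)
  (mu : 'I_n -> R) : 'M[R]_n := conj_diag (basis_mx v) (basis_mx v)^T mu.

Lemma basis_mx_orthogonal (R : realType) (n : nat) (v : 'I_n -> 'cV[R]_n) :
  orthonormal_basis v -> (basis_mx v)^T *m basis_mx v = 1%:M.
Proof.
move=> hv; apply/matrixP => i j; rewrite !mxE -(hv i j) !mxE.
by apply: eq_bigr => k _; rewrite !mxE.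
Qed.

Lemma eigenpairs_with_spectrum (R : realType) (n : nat) (M : 'M[R]_n)
    (lam : 'I_n -> R) (v : 'I_n -> 'cV[R]_n) :
  orthonormal_basis v -> eigenpairs M lam v -> M = with_spectrum v lam.
Proof.
move=> /basis_mx_orthogonal vv hM; have vv' := mulmx1C vv.
rewrite -[LHS]mulmx1 -vv' mulmxA; congr (_ *m _); apply/matrixP => i j.
have /matrixP /(_ i 0) := hM j; rewrite mul_mx_diag !mxE mulrC => <-.
by apply: eq_bigr => k _; rewrite !mxE.
Qed.

Lemma dot_self_gt0 (R : realType) (n : nat) (x : 'cV[R]_n) :
  x != 0 -> 0 < (x^T *m x) 0 0.
Proof.
move=> /cV0Pn [i xi]; rewrite mxE (bigD1 i) //= ltr_pwDl //.
  by rewrite !mxE -expr2 exprn_even_gt0.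
by apply: sumr_ge0 => j _; rewrite !mxE -expr2 sqr_ge0.
Qed.

Lemma posdef_eigen_gt0 (R : realType) (n : nat) (M : 'M[R]_n) (x : 'cV[R]_n) (a : R) :
  posdef M -> x != 0 -> M *m x = a *: x -> 0 < a.
Proof.
move=> [_ pM] x0 Mx; have := pM x x0.
by rewrite -mulmxA Mx -scalemxAr mxE pmulr_lgt0 // dot_self_gt0.
Qed.

Lemma posdef_with_spectrum (R : realType) (n : nat) (v : 'I_n -> 'cV[R]_n)
    (mu : 'I_n -> R) :
  orthonormal_basis v -> (forall i, 0 < mu i) -> posdef (with_spectrum v mu).
Proof.
move=> /basis_mx_orthogonal vv mu0; have vv' := mulmx1C vv; split.
  by rewrite /with_spectrum /conj_diag !trmx_mul trmxK tr_diag_mx mulmxA.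
move=> x x0; set y := (basis_mx v)^T *m x.
have y0 : y != 0.
  by apply: contraNneq x0 => e; rewrite -[x]mul1mx -vv' -mulmxA -/y e mulmx0.
have -> : x^T *m with_spectrum v mu *m x = y^T *m (diag_mx (\row_i mu i) *m y).
  by rewrite /with_spectrum /conj_diag /y trmx_mul trmxK !mulmxA.
clearbody y; have /cV0Pn [i yi] := y0; rewrite mxE (bigD1 i) //= ltr_pwDl //.
  by rewrite mul_diag_mx !mxE mulrCA -expr2 mulr_gt0 ?exprn_even_gt0.
by apply: sumr_ge0 => j _; rewrite mul_diag_mx !mxE mulrCA -expr2 mulr_ge0 ?sqr_ge0 // ltW.
Qed.

Lemma ln_prod (R : realType) (I : finType) (x : I -> R) : (forall i, 0 < x i) ->
  ln (\prod_i x i) = \sum_i ln (x i).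
Proof.
move=> x0.
suff [] : 0 < \prod_i x i /\ ln (\prod_i x i) = \sum_i ln (x i) by [].
elim/big_ind2 : _ => [|y a z b [y0 <-] [z0 <-]|//]; first by rewrite ln1.
by rewrite mulr_gt0 // lnM.
Qed.

Lemma objective_with_spectrum (R : realType) (n : nat) (v : 'I_n -> 'cV[R]_n)
    (lam mu : 'I_n -> R) :
  orthonormal_basis v -> (forall i, 0 < lam i) -> (forall i, 0 < mu i) ->
  objective (with_spectrum v lam) (with_spectrum v mu) = spectral_cost lam mu.
Proof.
move=> /basis_mx_orthogonal vv lam0 mu0; have vv' := mulmx1C vv.
rewrite /objective invmx_conj_diag // => [|i]; last by rewrite gt_eqF.
rewrite conj_diag_mul // det_conj_diag // /conj_diag mxtrace_mulC mulmxA vv mul1mx.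
rewrite mxtrace_diag /spectral_cost /sub_ln sumrB; congr (_ - _).
  by apply: eq_bigr => i _; rewrite mxE mulrC.
have pos i : 0 < (mu i)^-1 * lam i by rewrite mulr_gt0 ?invr_gt0.
by rewrite ln_prod //; apply: eq_bigr => i _; rewrite mulrC.
Qed.

Lemma low_rank_update_with_spectrum (R : realType) (m n : nat)
    (v : 'I_n -> 'cV[R]_n) (mu : 'I_n -> R) (P : pred 'I_n) (b : R) :
  orthonormal_basis v -> (m < n)%N -> #|P| = (n - m)%N ->
  (forall i, P i -> mu i = b) -> low_rank_update m (with_spectrum v mu).
Proof.
move=> /basis_mx_orthogonal vv mn cP mub; have vv' := mulmx1C vv.
have cC : #|predC P| = m by apply: (@addnI (n - m)%N); rewrite -{1}cP cardC card_ord subnK // ltnW.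
(* Writing [m] as the cardinality of the complement of [P] lets [enum_val] list the eigenvectors
   whose shifted eigenvalue may be nonzero. *)
exists b; rewrite -cC.
exists (fun k => mu (enum_val k) - b), (fun k => v (enum_val k)).
rewrite -(big_enum_val (fun i => (mu i - b) *: (v i *m (v i)^T))) /=.
have -> : \sum_(i in predC P) (mu i - b) *: (v i *m (v i)^T) =
    \sum_i (mu i - b) *: (v i *m (v i)^T).
  rewrite [RHS](bigID P) /= [X in _ = X + _]big1 ?add0r // => i iP.
  by rewrite mub // subrr scale0r.
apply/eqP; rewrite addrC -subr_eq -(conj_diag_const b vv') conj_diagB; apply/eqP.
apply/matrixP => i j; rewrite summxE mxE; apply: eq_bigr => k _.
by rewrite mul_mx_diag !mxE big_ord1 !mxE; ring.
Qed.

(** * Complex diagonalisation and eigenvector overlaps *)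

Lemma map_conj_diag (R : realType) (n : nat) (Q P : 'M[R]_n) (d : 'I_n -> R) :
  map_mx (real_complex R) (conj_diag Q P d) =
  conj_diag (map_mx (real_complex R) Q) (map_mx (real_complex R) P)
    (fun i => real_complex R (d i)).
Proof.
have dE : map_mx (real_complex R) (\row_i d i) = \row_i real_complex R (d i).
  by apply/rowP => i; rewrite !mxE.
by rewrite /conj_diag !map_mxM map_diag_mx dE.
Qed.

Lemma map_real_complex_conj (R : realType) (m n : nat) (A : 'M[R]_(m, n)) :
  (map_mx (real_complex R) A)^t* = (map_mx (real_complex R) A)^T.
Proof. by apply/matrixP => i j; rewrite !mxE; exact: conjc_real. Qed.

(* Diagonalising over [R[i]] suffices: only the moduli of the entries of [P] matter. *)
Lemma posdef_spectral (R : realType) (n : nat) (Y : 'M[R]_n) : posdef Y ->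
  exists (P : 'M[R[i]]_n) (d : 'I_n -> R),
    [/\ P *m P^t* = 1%:M, forall i, 0 < d i &
        map_mx (real_complex R) Y =
        conj_diag (P^t*) P (fun i => real_complex R (d i))].
Proof.
move=> pY; set Yc := map_mx _ Y.
have Yherm : Yc \is hermsymmx.
  by apply/is_hermitianmxP; rewrite expr0 scale1r map_real_complex_conj map_trmx pY.1.
have sp : Yc = invmx (spectralmx Yc) *m diag_mx (spectral_diag Yc) *m spectralmx Yc.
  by apply/orthomx_spectralP; exact: hermitian_normalmx.
have Pu := spectral_unitarymx Yc.
have real := hermitian_spectral_diag_real Yherm.
pose d i := complex.Re (spectral_diag Yc 0 i).
have dE i : real_complex R (d i) = spectral_diag Yc 0 i.
  by rewrite /d RRe_real // (mxOverP real).
have YcE : Yc = conj_diag ((spectralmx Yc)^t*) (spectralmx Yc) (fun i => real_complex R (d i)).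
  have rowE : \row_i real_complex R (d i) = spectral_diag Yc.
    by apply/rowP => i; rewrite mxE dE.
  by rewrite /conj_diag rowE -invmx_unitary.
have PP := unitarymxP Pu; have PP' := mulmx1C PP.
exists (spectralmx Yc), d; split => // i.
(* Positive definiteness needs a real eigenvector for [d i]; the vanishing determinant descends from
   [R[i]] to [R] and provides one. *)
have : \det (Y - (d i)%:M) == 0.
  apply/eqP/(@complexI R); rewrite -det_map_mx rmorph0 map_mxB map_scalar_mx /=.
  rewrite -/Yc YcE -(conj_diag_const _ PP') conj_diagB det_conj_diag //.
  by rewrite (bigD1 i) //= subrr mul0r.
move=> /det0P [w w0] /eqP; rewrite mulmxBr subr_eq0 mul_mx_scalar => /eqP wY.
apply: (@posdef_eigen_gt0 _ _ Y w^T) => //; first by rewrite trmx_eq0.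
by rewrite -[Y]trmxK pY.1 -trmx_mul wY linearZ.
Qed.

(** The matrix [U = P *m V] of overlaps between the two eigenbases is unitary, so its squared moduli
    have row and column sums 1. They are the weights in the expanded trace, while the determinant
    sees only the two spectra. *)
Lemma objective_overlap (R : realType) (n : nat) (v : 'I_n -> 'cV[R]_n)
    (lam : 'I_n -> R) (Y : 'M[R]_n) :
  orthonormal_basis v -> (forall i, 0 < lam i) -> posdef Y ->
  exists (D : 'I_n -> 'I_n -> R) (d : 'I_n -> R),
  [/\ forall i j, 0 <= D i j, forall i, \sum_j D i j = 1,
      forall j, \sum_i D i j = 1, forall j, 0 < d j &
      (forall b, (#|[set j | d j != b]| <= \rank (Y - b%:M)%R)%N) /\
      objective (with_spectrum v lam) Y =
      \sum_i \sum_j D i j * (lam i * (d j)^-1) - ln (\prod_i (lam i / d i))].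
Proof.
move=> /basis_mx_orthogonal vv lam0 pY; have vv' := mulmx1C vv.
have [P [d [PP d0 YE]]] := posdef_spectral pY; have PP' := mulmx1C PP.
pose r : {rmorphism R -> R[i]} := real_complex R.
change (map_mx r Y = conj_diag (P^t*) P (fun i => r (d i))) in YE.
pose V := map_mx r (basis_mx v).
have VV : V^T *m V = 1%:M by rewrite /V map_trmx -map_mxM vv map_mx1.
have VV' := mulmx1C VV.
pose U := P *m V.
have Ut : U^t* = V^T *m P^t*.
  by rewrite /U trmx_mul map_mxM map_real_complex_conj.
have UU : U *m U^t* = 1%:M by rewrite Ut /U mulmxA -(mulmxA P) VV' mulmx1.
have UU' := mulmx1C UU.
(* The squared modulus is already real, so [Re] only changes its type; the indices of [U] are
   swapped so that [i] refers to [lam]. *)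
pose D i j := complex.Re (`|U j i| ^+ 2).
have DE i j : r (D i j) = `|U j i| ^+ 2 by apply: RRe_real; rewrite rpredX // normr_real.
exists D, d; split => //.
- by move=> i j; rewrite -ler0c (DE i j) exprn_ge0.
- move=> i; apply: (fmorph_inj r); rewrite rmorph_sum rmorph1.
  have /matrixP /(_ i i) := UU'; rewrite !mxE eqxx => e; rewrite -[RHS]e.
  by apply: eq_bigr => j _; rewrite DE !mxE normCK mulrC.
- move=> j; apply: (fmorph_inj r); rewrite rmorph_sum rmorph1.
  have /matrixP /(_ j j) := UU; rewrite !mxE eqxx => e; rewrite -[RHS]e.
  by apply: eq_bigr => i _; rewrite DE !mxE normCK.
split.
  move=> b; rewrite -(mxrank_map r) map_mxB map_scalar_mx YE.
  apply: leq_trans (rank_conj_diag_ge _ _ PP).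
  by apply: subset_leq_card; apply/subsetP => j; rewrite !inE (inj_eq (fmorph_inj r)).
have d0c i : r (d i) != 0 by rewrite fmorph_eq0 gt_eqF.
have AE : map_mx r (with_spectrum v lam) = conj_diag V V^T (fun i => r (lam i)).
  by rewrite map_trmx; exact: map_conj_diag.
rewrite /objective; congr (_ - ln _); apply: (fmorph_inj r).
  rewrite -trace_map_mx map_mxM map_invmx YE invmx_conj_diag // AE.
  rewrite /conj_diag !mulmxA mxtrace_mulC !mulmxA -/U.
  rewrite -Ut -(mulmxA _ P V) -/U rmorph_sum; apply: eq_bigr => i _.
  rewrite mul_mx_diag mxE mxE rmorph_sum mulr_suml; apply: eq_bigr => j _.
  clearbody U; rewrite mul_mx_diag !mxE !rmorphM fmorphV DE normCK; ring.
rewrite -det_map_mx map_mxM map_invmx YE invmx_conj_diag // AE det_mulmx.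
rewrite !det_conj_diag // -big_split rmorph_prod; apply: eq_bigr => i _.
by rewrite mulrC rmorphM fmorphV.
Qed.

(** * The bound for feasible matrices and the characterisation *)

Lemma card_level_ge (T : eqType) (m n : nat) (e : 'I_n -> T) (b : T) :
  (#|[set i | e i != b]| <= m)%N -> (n - m <= #|[set i | e i == b]|)%N.
Proof.
move=> le_m; rewrite leq_subLR -[leqLHS]card_ord -(cardsC [set i | e i == b]).
have -> : ~: [set i | e i == b] = [set i | e i != b].
  by apply/setP => i; rewrite !inE.
by rewrite addnC leq_add2r.
Qed.

(** After sorting [d], its reciprocals are nonincreasing while [lam] is nondecreasing, so the
    rearrangement inequality bounds the trace. The logarithmic part is invariant under permuting
    [d], and the rank bound provides the long level set. *)
Lemma feasible_objective_ge (R : realType) (m n : nat) (v : 'I_n -> 'cV[R]_n)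
    (lam : 'I_n -> R) (Y : 'M[R]_n) : (m < n)%N -> orthonormal_basis v ->
  (forall i j : 'I_n, (i <= j)%N -> lam i <= lam j) -> (forall i, 0 < lam i) ->
  feasible m Y ->
  exists l : 'I_m.+1, block_cost lam l + m%:R <= objective (with_spectrum v lam) Y.
Proof.
move=> mn hv hord lam0 [/low_rank_update_rank [b rb] pY].
have [D [d [D0 rows cols d0 [rd ->]]]] := objective_overlap hv lam0 pY.
have [s ds] := sorting_perm d.
have [||l hl] := @sorted_cost_bound R m n lam (fun i => d (s i)) b mn lam0 _ ds.
- by [].
- have -> : [set i | d (s i) == b] = [set i | s i \in [set j | d j == b]].
    by apply/setP => i; rewrite !inE.
  by rewrite card_preim_perm; apply: card_level_ge; exact: leq_trans (rd b) rb.
exists l; apply: (le_trans hl).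
rewrite /spectral_cost /sub_ln sumrB; apply: lerB.
  under [leRHS]eq_bigr => i _ do rewrite (reindex_inj (@perm_inj _ s)).
  apply: (doubly_stochastic_rearrangement (D := fun i j => D i (s j))) => //.
    by move=> i; rewrite -(rows i) [RHS](reindex_inj (@perm_inj _ s)).
  by move=> i j /ds; rewrite lef_pV2 ?posrE.
rewrite ln_prod => [|i]; last by rewrite divr_gt0.
have lnE (e : 'I_n -> R) : (forall i, 0 < e i) ->
    \sum_i ln (lam i / e i) = \sum_i ln (lam i) - \sum_i ln (e i).
  by move=> e0; rewrite -sumrB; apply: eq_bigr => i _; rewrite ln_div ?posrE.
by rewrite !lnE // [X in _ - X](reindex_inj (@perm_inj _ s)).
Qed.

Lemma feasible_with_spectrum (R : realType) (m n : nat) (v : 'I_n -> 'cV[R]_n)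
    (mu : 'I_n -> R) (P : pred 'I_n) (b : R) :
  (m < n)%N -> orthonormal_basis v -> (forall i, 0 < mu i) -> #|P| = (n - m)%N ->
  (forall i, P i -> mu i = b) -> feasible m (with_spectrum v mu).
Proof.
move=> mn hv mu0 cP mub; split; last exact: posdef_with_spectrum.
exact: low_rank_update_with_spectrum mub.
Qed.

Lemma eigenpairs_gt0 (R : realType) (n : nat) (M : 'M[R]_n) (lam : 'I_n -> R)
    (v : 'I_n -> 'cV[R]_n) :
  orthonormal_basis v -> posdef M -> eigenpairs M lam v -> forall i, 0 < lam i.
Proof.
move=> hv pM hM i; apply: posdef_eigen_gt0 pM _ (hM i); apply/eqP => v0.
by have := hv i i; rewrite v0 mulmx0 mxE eqxx => /eqP; rewrite eq_sym oner_eq0.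
Qed.

Theorem theorem6 (R : realType) (m n : nat) (hmn : (m < n)%N) (A : 'M[R]_n)
    (hA : posdef A) (lam : 'I_n -> R) (v : 'I_n -> 'cV[R]_n)
    (hv : orthonormal_basis v) (hlam : eigenpairs A lam v)
    (hord : forall i j : 'I_n, (i <= j)%N -> lam i <= lam j)
    (X : 'M[R]_n) (mu : 'I_n -> R) (hX : eigenpairs X mu v) :
  optimal m A X <->
  exists s : 'S_n, tie_relabelling lam s /\
  exists l : 'I_m.+1, block_minimizer lam l /\
    forall i : 'I_n, mu (s i) = block_spectrum lam l i.
Proof.
have lam0 := eigenpairs_gt0 hv hA hlam.
have AE := eigenpairs_with_spectrum hv hlam.
have XE := eigenpairs_with_spectrum hv hX.
have costE e : (forall i, 0 < e i) -> spectral_cost lam e = objective A (with_spectrum v e).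
  by move=> e0; rewrite AE objective_with_spectrum.
split=> [[[lX pX] Xopt]|[s [tie [l [lmin muE]]]]].
  have mu0 := eigenpairs_gt0 hv pX hX.
  have [b rb] := low_rank_update_rank lX.
  have : (n - m <= #|[set i | mu i == b]|)%N.
    apply: card_level_ge; apply: leq_trans rb; rewrite XE.
    exact: rank_conj_diag_ge (basis_mx_orthogonal hv).
  (* The level set may have more than [n - m] elements, so a subset of exactly that size is
     chosen. *)
  move=> /card_geqP [S0 [uS0 sS0 subS0]].
  have cS : #|[set i in S0]| = (n - m)%N by rewrite cardsE (card_uniqP uS0).
  apply: (optimal_spectrum_block hmn hord lam0 mu0 cS (b := b)) => [i|S' cS'].
    by rewrite inE => /subS0; rewrite inE => /eqP.
  have S'0 := averaged_on_gt0 (mem S') lam0.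
  rewrite (costE _ mu0) (costE _ S'0) -XE; apply: Xopt.
  apply: (feasible_with_spectrum hmn hv S'0 cS') => i iS.
  by rewrite /averaged_on (_ : mem S' i = true).
have mu0 k : 0 < mu k.
  by rewrite -[k](permKV s) muE block_spectrumE // averaged_on_gt0.
split=> [|Y feasY].
  (* The block is transported by [s], because [mu] takes its common value at the images under [s] of
     the block indices. *)
  rewrite XE; pose P : pred 'I_n := [pred i | in_block l ((s^-1)%g i)].
  apply: (feasible_with_spectrum (P := P) (b := block_mean lam l)) => // [|k kl].
    rewrite -(@card_in_block m n l hmn) -[RHS]cardsE -(card_preim_perm (s^-1)%g).
    by apply: eq_card => i; rewrite !inE.
  by rewrite -[k](permKV s) muE /block_spectrum [in_block _ _]kl.
have [l' hl'] := feasible_objective_ge hmn hv hord lam0 feasY.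
rewrite -AE in hl'; apply: le_trans hl'; rewrite XE -costE //.
(* Reindexing by [s] turns [mu] into the block spectrum and, by the ties, leaves [lam] fixed;
   minimality of [l] then beats the block [l'] that bounds [Y]. *)
have -> : spectral_cost lam mu = spectral_cost lam (block_spectrum lam l).
  rewrite /spectral_cost (reindex_inj (@perm_inj _ s)) /=.
  by apply: eq_bigr => x _; rewrite muE tie.
by rewrite spectral_cost_block // lerD2r.
Qed.
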